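(* For every graph $G$ on $n\ge3$ vertices and every integer $t\in[3,n]$ we have $$ex(G,C_t)\ge\frac{ex(n,C_t)}{\binom n2}\,e(G).$$
   Context: Graphs are finite and simple; $e(G)$ is the number of edges of $G$; $C_t$ is the cycle of length $t$ (with $t$ edges). For graphs $G,H$, $ex(G,H)$ is the maximum number of edges in a subgraph of $G$ containing no copy of $H$, and $ex(n,H)=ex(K_n,H)$ is the maximum number of edges in a graph on $n$ vertices containing no copy of $H$ as a (not necessarily induced) subgraph. *)

(* Defs.v *)
From mathcomp Require Import all_boot.

Set Implicit Arguments.
Unset Strict Implicit.
Unset Printing Implicit Defensive.

Record sgraph := SGraph {
  vertex :> finType;
  adj : rel vertex;
  adj_sym : symmetric adj;
  adj_irrefl : irreflexive adj
}.

Definition edges (G : sgraph) : {set {set G}} :=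
  [set [set p.1; p.2] | p : G * G & adj p.1 p.2].

Definition num_edges (G : sgraph) : nat := #|edges G|.

(* A subgraph is a pair (W, F) of a vertex set and an edge set; it need be
   neither spanning nor induced. *)
Definition is_subgraph (G : sgraph) (S : {set G} * {set {set G}}) : bool :=
  (S.2 \subset edges G) && (cover S.2 \subset S.1).

Definition contains_copy (G : sgraph) (S : {set G} * {set {set G}})
    (H : sgraph) : bool :=
  [exists f : {ffun H -> G},
    [&& injectiveb f,
        [forall x, f x \in S.1]
      & [forall x, forall y, adj x y ==> ([set f x; f y] \in S.2)]]].

(* The maximum is 0 when no subgraph qualifies, which only happens when H has
   no vertices. *)
Definition ex (G H : sgraph) : nat :=
  \max_(S : {set G} * {set {set G}}
       | is_subgraph S && ~~ contains_copy S H) #|S.2|.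

Section Complete.
Variable n : nat.

Definition complete_adj : rel 'I_n := fun i j => i != j.

Lemma complete_adj_sym : symmetric complete_adj.
Proof. by move=> i j; rewrite /complete_adj eq_sym. Qed.

Lemma complete_adj_irrefl : irreflexive complete_adj.
Proof. by move=> i; rewrite /complete_adj eqxx. Qed.

Definition complete_graph : sgraph :=
  SGraph complete_adj_sym complete_adj_irrefl.
End Complete.

Section Cycle.
Variable t : nat.

(* ordS is the successor modulo t.  This is the cycle of length t only for
   3 <= t; the condition i != j matters only for t = 1. *)
Definition cycle_adj : rel 'I_t :=
  fun i j => (i != j) && ((j == ordS i) || (i == ordS j)).

Lemma cycle_adj_sym : symmetric cycle_adj.
Proof. by move=> i j; rewrite /cycle_adj eq_sym orbC. Qed.

Lemma cycle_adj_irrefl : irreflexive cycle_adj.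
Proof. by move=> i; rewrite /cycle_adj eqxx. Qed.

Definition cycle_graph : sgraph := SGraph cycle_adj_sym cycle_adj_irrefl.
End Cycle.

(* Every graph on n vertices is, up to isomorphism, a spanning subgraph of K_n;
   adding isolated vertices to a non-spanning one changes neither its number of
   edges nor whether it contains H, when H has no isolated vertex. *)
Definition ex_num (n : nat) (H : sgraph) : nat := ex (complete_graph n) H.

(* Main.v *)
Require Import Defs.
From mathcomp Require Import all_boot all_order all_algebra all_fingroup.

Set Implicit Arguments.
Unset Strict Implicit.
Unset Printing Implicit Defensive.

Import Order.TTheory GRing.Theory Num.Theory.
Local Open Scope ring_scope.

(** Place an extremal $C_t$-free subgraph of $K_n$ on the vertices of $G$ by a
    uniformly random permutation.  Every edge of $G$ is kept with the same
    probability $ex(n,C_t)/\binom n2$, and the kept edges never contain $C_t$,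
    so some placement keeps at least the average number of edges. *)

Section Averaging.
Local Open Scope nat_scope.

(** Two transpositions suffice: the first sends [a] to [c], and the second sends the current image
    of [b] to [d] without moving [c]. *)
Lemma perm_imset_pair (T : finType) (A B : {set T}) :
  #|A| = 2 -> #|B| = 2 -> exists p : {perm T}, p @: A = B.
Proof.
move=> /eqP/cards2P[a [b [ab ->]]] /eqP/cards2P[c [d [cd ->]]].
exists (tperm a c * tperm (tperm a c b) d)%g.
rewrite imsetU !imset_set1 !permM tpermL tpermL tpermD //.
  by rewrite -[X in _ != X](tpermL a c) (inj_eq perm_inj) eq_sym.
by rewrite eq_sym.
Qed.

(** Left translation by a [p] carrying [A] to [B] permutes the summands, since [p * s] applies [p]
    first. This is the equal probability of all pairs. *)
Lemma sum_perm_imset_in (T : finType) (F : {set {set T}}) (A B : {set T}) :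
  #|A| = 2 -> #|B| = 2 ->
  \sum_(s : {perm T}) (s @: A \in F) = \sum_(s : {perm T}) (s @: B \in F).
Proof.
move=> hA hB; have [p <-] := perm_imset_pair hA hB.
rewrite (reindex_inj (mulgI p)) /=; apply: eq_bigr => s _.
by rewrite -imset_comp; congr (nat_of_bool (_ \in F)); apply: eq_imset => x;
  rewrite /= permM.
Qed.

Lemma card_set_in (T : finType) (E : {set T}) (P : pred T) :
  #|[set x in E | P x]| = \sum_(x in E) P x.
Proof.
rewrite -sum1_card big_mkcond [RHS]big_mkcond; apply: eq_bigr => x _.
by rewrite inE; case: (x \in E) (P x) => [] [].
Qed.

(** The expected number of kept edges, with denominators cleared. The factor ['C(#|T|, 2)] is read
    as a sum over all pairs [B], and each edge [A] is then traded for [B]. *)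
Lemma sum_card_perm_imset_in (T : finType) (E F : {set {set T}}) :
  {in E, forall A : {set T}, #|A| = 2} ->
  {in F, forall A : {set T}, #|A| = 2} ->
  'C(#|T|, 2) * \sum_(s : {perm T}) #|[set A in E | s @: A \in F]|
    = #|{perm T}| * #|E| * #|F|.
Proof.
move=> E2 F2; rewrite -cardsT -cards_draws -sum_nat_const.
set pairs := [set A | _].
under eq_bigr => B _ do
  (under eq_bigr => s _ do rewrite card_set_in; rewrite exchange_big /=).
transitivity (\sum_(B in pairs) \sum_(A in E)
                \sum_(s : {perm T}) (s @: B \in F)).
  apply: eq_bigr => B; rewrite inE subsetT => /eqP B2.
  by apply: eq_bigr => A /E2 A2; apply: sum_perm_imset_in.
under eq_bigr => B _ do rewrite sum_nat_const.
rewrite -big_distrr exchange_big /= mulnAC mulnC; congr (_ * _).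
(* For fixed [s], taking images is a bijection on pairs, so exactly [#|F|] pairs land in [F]. *)
under eq_bigr => s _.
  rewrite -card_set_in -(card_imset _ (imset_inj (@perm_inj _ s))).
  rewrite (_ : _ @: _ = F); first over.
  apply/setP => A; apply/imsetP/idP => [[B]|AF].
    by rewrite inE => /andP[_ BF] ->.
  have sA: s @: ((s^-1)%g @: A) = A.
    rewrite -imset_comp -[RHS]imset_id; apply: eq_imset => x.
    by rewrite /= permKV.
  exists ((s^-1)%g @: A); last by rewrite sA.
  by rewrite !inE subsetT sA AF andbT /= (card_imset _ perm_inj) F2.
by rewrite sum_nat_const.
Qed.

Lemma edges_card2 (G : sgraph) (A : {set G}) : A \in edges G -> #|A| = 2.
Proof.
case/imsetP => -[x y]; rewrite inE /= => xy ->.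
by rewrite cards2; case: eqP xy => // ->; rewrite adj_irrefl.
Qed.

(** Pulling [S] back along [g] creates no copy of [H]: composing such a copy with the injection [g]
    would give one in [S]. *)
Lemma card_preim_le_ex (G K H : sgraph) (g : G -> K)
    (S : {set K} * {set {set K}}) :
  injective g -> is_subgraph S -> ~~ contains_copy S H ->
  #|[set A in edges G | g @: A \in S.2]| <= ex G H.
Proof.
move=> g_inj /andP[_ covS] freeS.
apply: (@leq_bigmax_cond _ _ (fun X : {set G} * {set {set G}} => #|X.2|)
  (g @^-1: S.1, [set A in edges G | g @: A \in S.2])).
rewrite /is_subgraph /=; apply/andP; split.
  apply/andP; split; first by apply/subsetP => A; rewrite inE => /andP[].
  apply/bigcupsP => A; rewrite inE => /andP[_ gA]; rewrite -sub_imset_pre.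
  exact: subset_trans (bigcup_sup _ gA) covS.
apply: contra freeS => /existsP[f /and3P[/injectiveP f_inj /forallP fV fE]].
apply/existsP; exists [ffun x => g (f x)]; apply/and3P; split.
- by apply/injectiveP => x y; rewrite !ffunE => /g_inj/f_inj.
- by apply/forallP => x; have := fV x; rewrite ffunE inE.
apply/forallP => x; apply/forallP => y; apply/implyP => xy.
have /forallP/(_ x)/forallP/(_ y)/implyP/(_ xy) := fE.
by rewrite inE !ffunE imsetU !imset_set1 => /andP[].
Qed.

Lemma ex_num_edges_le (G H : sgraph) (n : nat) (g : G -> 'I_n) :
  injective g -> ex_num n H * num_edges G <= 'C(n, 2) * ex G H.
Proof.
move=> g_inj; rewrite big_distrl /=.
apply/bigmax_leqP => S /andP[subS freeS].
(* Scaling by the number of permutations turns the averages into sums over [s], to be compared term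
   by term. *)
rewrite -(leq_pmul2l (_ : 0 < #|{perm 'I_n}|)); last first.
  by apply/card_gt0P; exists 1%g.
have gI := imset_inj g_inj.
(* The edges of [G] are moved into ['I_n] along [g], where the permutations act. *)
rewrite /num_edges mulnA mulnAC -(card_imset _ gI).
rewrite -sum_card_perm_imset_in; first last.
- by case/andP: subS => /subsetP sE _ A /sE /edges_card2.
- by move=> _ /imsetP[A /edges_card2 A2 ->]; rewrite card_imset.
rewrite card_ord mulnCA leq_mul2l -sum_nat_const; apply/orP; right.
apply: leq_sum => s _.
have sg_inj : injective (s \o g) by apply: inj_comp g_inj; apply: perm_inj.
apply: leq_trans (card_preim_le_ex (K := complete_graph n) sg_inj subS freeS).
(* The kept edges, counted in ['I_n], are images under [g] of edges of [G] that [s \o g] sends into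
   [S.2]. *)
rewrite -(card_imset [set A in edges G | _] gI).
apply/subset_leq_card/subsetP => _ /[!inE] /andP[/imsetP[A AE ->] sgA].
by apply: imset_f; rewrite inE AE imset_comp.
Qed.

End Averaging.

Theorem fact1p7 (n t : nat) (G : sgraph) (hn : (3 <= n)%N)
    (hG : #|vertex G| = n) (ht : (3 <= t <= n)%N) :
  (ex G (cycle_graph t))%:R >=
    (ex_num n (cycle_graph t))%:R / ('C(n, 2))%:R * (num_edges G)%:R :> rat.
Proof.
have g_inj : injective (fun x : G => cast_ord hG (enum_rank x)).
  by move=> x y /cast_ord_inj/enum_rank_inj.
rewrite mulrAC ler_pdivrMr; last by rewrite ltr0n bin_gt0 ltnW.
by rewrite -!natrM ler_nat [leqRHS]mulnC (ex_num_edges_le _ g_inj).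
Qed.
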